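(* Let $k\in\mathbb{N}$, $k\geq 1$, let $f:{}^*\mathbb{R}\to{}^*\mathbb{R}$ be an internal function that is $k$-times mu-differentiable, with successive mu-derivatives $f',f'',\ldots,f^{(k)}$, and let $a\in\mathbb{R}$. If $a$ is a local m-minimizer of $f$ and $$f'(a)\approx f''(a)\approx\cdots\approx f^{(k-1)}(a)\approx 0,$$ then (1) $f^{(k)}(a)\approx 0$ if $k$ is odd; (2) $f^{(k)}(a)\gtrsim 0$ if $k$ is even.
   Context: Setting: nonstandard analysis; ${}^*\mathbb{R}$ is the field of hyperreals (a nonstandard extension of $\mathbb{R}$ satisfying the Transfer Principle), with the usual notion of internal sets and functions. ${}^*]b,c[$ denotes the nonstandard extension of the open interval $]b,c[$. For $x,y\in{}^*\mathbb{R}$: $x\approx 0$ ($x$ is infinitesimal) means $|x|<r$ for all real $r>0$; $x\approx y$ means $x-y\approx 0$; $x$ is finite if $|x|<r$ for some real $r>0$; $x$ is nearstandard, $x\in ns({}^*\mathbb{R})$, if $x\approx b$ for some (unique) $b\in\mathbb{R}$. We write $x\gtrsim y$ if $x\ge y$ or $x\approx y$. Mu-differentiability: an internal function $f:{}^*\mathbb{R}\to{}^*\mathbb{R}$ is mu-differentiable if $f(ns({}^*\mathbb{R}))\subseteq ns({}^*\mathbb{R})$ and there is an internal function $f':{}^*\mathbb{R}\to{}^*\mathbb{R}$ (a mu-derivative of $f$, in general not unique) such that (1) $f'(x)$ is finite whenever $x$ is nearstandard; (2) for each $b\in\mathbb{R}$ there is a positive infinitesimal $\delta_b$ such that for all $x,y\approx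 b$ with $|x-y|>\delta_b$ there is an infinitesimal $\eta$ with $f(x)-f(y)=f'(x)(x-y)+|x-y|\eta$. The function $f$ is $k$-times mu-differentiable if there are internal functions $f^{(0)}=f, f^{(1)}=f',\ldots,f^{(k)}$ such that, for $0\le j\le k-1$, $f^{(j)}$ is mu-differentiable with mu-derivative $f^{(j+1)}$. A point $a\in\mathbb{R}$ is a local m-minimizer of $f$ if there is a real $r>0$ such that $f(x)\gtrsim f(a)$ for all $x\in{}^*]a-r,a+r[$. For $k=1$ the displayed condition on the derivatives of order at most $k-1$ is empty. *)

(* Defs.v *)
From HB Require Import structures.
From mathcomp Require Import all_boot all_order all_algebra.
From mathcomp Require Import boolp classical_sets set_interval reals.

Set Implicit Arguments.
Unset Strict Implicit.
Unset Printing Implicit Defensive.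

Import Order.TTheory GRing.Theory Num.Theory.
Local Open Scope ring_scope.
Local Open Scope classical_set_scope.

(* The standard universe is the finite-type hierarchy over the reals: the
   reals, closed under power sets and function spaces. Relations and functions
   of several arguments are curried. A nonstandard extension interprets every
   sort by its internal objects, and Transfer says that [star] preserves and
   reflects the truth of every formula of the many-sorted first-order language
   of membership and application. Quantifiers over a sort of the extension
   range over the internal objects of that sort. *)

Inductive nsort : Type := Reals | Pow of nsort | Arr of nsort & nsort.

Record structure : Type := Structure {
  dom :> nsort -> Type;
  smem : forall s, dom s -> dom (Pow s) -> Prop;
  sapp : forall s t, dom (Arr s t) -> dom s -> dom t }.

Fixpoint std_dom (R : realType) (s : nsort) : Type :=
  match s with
  | Reals => R
  | Pow s => set (std_dom R s)
  | Arr s t => std_dom R s -> std_dom R t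
  end.

Definition standard (R : realType) : structure :=
  @Structure (std_dom R) (fun s x A => A x) (fun s t f x => f x).

(* Well-sorted de Bruijn variables: [lvar G s] is a position of sort [s] in the
   context [G]. *)
Inductive lvar : seq nsort -> nsort -> Type :=
  | VZ G s : lvar (s :: G) s
  | VS G s t of lvar G s : lvar (t :: G) s.

Inductive lterm (G : seq nsort) : nsort -> Type :=
  | Var s of lvar G s : lterm G s
  | App s t of lterm G (Arr s t) & lterm G s : lterm G t.

Inductive lform : seq nsort -> Type :=
  | Eq G s of lterm G s & lterm G s : lform G
  | Mem G s of lterm G s & lterm G (Pow s) : lform G
  | Bot G : lform G
  | Imp G of lform G & lform G : lform G
  | And G of lform G & lform G : lform G
  | Or G of lform G & lform G : lform G
  | All G s of lform (s :: G) : lform G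
  | Ex G s of lform (s :: G) : lform G.

Fixpoint lenv (M : structure) (G : seq nsort) : Type :=
  if G is s :: G' then (M s * lenv M G')%type else unit.

Fixpoint lookup (M : structure) G s (x : lvar G s) : lenv M G -> M s :=
  match x in lvar G s return lenv M G -> M s with
  | VZ _ _ => fun e => e.1
  | VS _ _ _ y => fun e => lookup y e.2
  end.

Fixpoint leval (M : structure) G (e : lenv M G) s (t : lterm G s) : M s :=
  match t with
  | Var _ x => lookup x e
  | App _ _ f u => sapp (leval e f) (leval e u)
  end.

Fixpoint holds (M : structure) G (phi : lform G) : lenv M G -> Prop :=
  match phi in lform G return lenv M G -> Prop with
  | Eq _ _ t u => fun e => leval e t = leval e u
  | Mem _ _ t u => fun e => smem (leval e t) (leval e u)
  | Bot _ => fun _ => False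
  | Imp _ p q => fun e => holds p e -> holds q e
  | And _ p q => fun e => holds p e /\ holds q e
  | Or _ p q => fun e => holds p e \/ holds q e
  | All _ s p => fun e => forall x : M s, @holds M _ p (x, e)
  | Ex _ s p => fun e => exists x : M s, @holds M _ p (x, e)
  end.

Fixpoint lenv_map (M N : structure) (h : forall s, M s -> N s) G :
    lenv M G -> lenv N G :=
  if G is s :: G' return lenv M G -> lenv N G
  then fun e => (h s e.1, lenv_map h e.2) else fun e => e.

(* Standard parameters enter a formula through its free variables. *)
Record nonstandard_extension (R : realType) : Type := NonstandardExtension {
  ext :> structure;
  star : forall s, standard R s -> ext s;
  transfer : forall G (phi : lform G) (e : lenv (standard R) G),
    holds phi e <-> holds phi (lenv_map star e);
  proper : exists x : ext Reals, forall r : R, x <> star (s := Reals) r }.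

Definition hyper (R : realType) (E : nonstandard_extension R) : Type :=
  E Reals.

Definition hstd (R : realType) (E : nonstandard_extension R) (r : R) :
  hyper E := star E (s := Reals) r.

Definition hfun (R : realType) (E : nonstandard_extension R) (u : R -> R)
  (x : hyper E) : hyper E := sapp (star E (s := Arr Reals Reals) u) x.

Definition hfun2 (R : realType) (E : nonstandard_extension R)
    (u : R -> R -> R) (x y : hyper E) : hyper E :=
  sapp (sapp (star E (s := Arr Reals (Arr Reals Reals)) u) x) y.

Definition hset (R : realType) (E : nonstandard_extension R) (A : set R) :
  set (hyper E) := [set x | smem x (star E (s := Pow Reals) A)].

Arguments hset {R} E A x.

Definition hrel (R : realType) (E : nonstandard_extension R)
    (u : R -> set R) (x y : hyper E) : Prop :=
  smem y (sapp (star E (s := Arr Reals (Pow Reals)) u) x).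

(* The operations and the order of the field of hyperreals are the star images
   of those of the reals; the axioms are obtained by Transfer. *)
Section FieldStructure.
Variables (R : realType) (E : nonstandard_extension R).
Implicit Types x y z : hyper E.

Let leset (r : R) : set R := [set s : R | r <= s].
Let fun1 := Arr Reals Reals.
Let fun2 := Arr Reals fun1.
Let rel2 := Arr Reals (Pow Reals).
Let ctx := [:: fun2; fun2; fun1; fun1; fun1; rel2; Reals; Reals].
Let ops : lenv (standard R) ctx :=
  (+%R, ( *%R, (-%R, (GRing.inv, ((Num.norm : R -> R),
    (leset, (0, (1, tt)))))))).

Let hadd := @hfun2 R E +%R.
Let hmul := @hfun2 R E *%R.
Let hopp := @hfun R E -%R.
Let hinv := @hfun R E GRing.inv.
Let habs := @hfun R E Num.norm.
Let hle (x y : hyper E) : bool := `[< @hrel R E leset x y >].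
Let h0 : hyper E := hstd E 0.
Let h1 : hyper E := hstd E 1.

Let vadd := VZ (behead ctx) fun2.
Let vmul : lvar ctx fun2 := VS _ (VZ _ _).
Let vopp : lvar ctx fun1 := VS _ (VS _ (VZ _ _)).
Let vinv : lvar ctx fun1 := VS _ (VS _ (VS _ (VZ _ _))).
Let vabs : lvar ctx fun1 := VS _ (VS _ (VS _ (VS _ (VZ _ _)))).
Let vle : lvar ctx rel2 := VS _ (VS _ (VS _ (VS _ (VS _ (VZ _ _))))).
Let v0 : lvar ctx Reals := VS _ (VS _ (VS _ (VS _ (VS _ (VS _ (VZ _ _)))))).
Let v1 : lvar ctx Reals :=
  VS _ (VS _ (VS _ (VS _ (VS _ (VS _ (VS _ (VZ _ _))))))).

Let ctx3 := [:: Reals, Reals, Reals & ctx].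
Let up t (u : lvar ctx t) : lterm ctx3 t := Var (VS _ (VS _ (VS _ u))).
Let X : lterm ctx3 Reals := Var (VS _ (VS _ (VZ _ _))).
Let Y : lterm ctx3 Reals := Var (VS _ (VZ _ _)).
Let Z : lterm ctx3 Reals := Var (VZ _ _).
Let A t u := App (App (up vadd) t) u.
Let M t u := App (App (up vmul) t) u.
Let N t := App (up vopp) t.
Let I t := App (up vinv) t.
Let B t := App (up vabs) t.
Let L t u := Mem u (App (up vle) t).
Let O := up v0.
Let U := up v1.

Let lift (phi : lform ctx3) :
  (forall x y z : R, @holds (standard R) _ phi (z, (y, (x, ops)))) ->
  forall x y z, @holds E _ phi (z, (y, (x, lenv_map (star E) ops))).
Proof. by move=> phiP; apply/(transfer E (All (All (All phi))) ops). Qed.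

Let lift1 (phi : lform ctx3) :
  (forall x y z : R, @holds (standard R) _ phi (z, (y, (x, ops)))) ->
  forall x, @holds E _ phi (x, (x, (x, lenv_map (star E) ops))).
Proof. by move=> /lift phiP x; apply: phiP. Qed.

Let lift2 (phi : lform ctx3) :
  (forall x y z : R, @holds (standard R) _ phi (z, (y, (x, ops)))) ->
  forall x y, @holds E _ phi (x, (y, (x, lenv_map (star E) ops))).
Proof. by move=> /lift phiP x y; apply: phiP. Qed.

Fact hyper_addA : associative hadd.
Proof. by apply: (@lift (Eq (A X (A Y Z)) (A (A X Y) Z))) => x y z; apply: addrA. Qed.

Fact hyper_addC : commutative hadd.
Proof. by apply: (@lift2 (Eq (A X Y) (A Y X))) => x y z; apply: addrC. Qed.

Fact hyper_add0 : left_id h0 hadd.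
Proof. by apply: (@lift1 (Eq (A O X) X)) => x y z; apply: add0r. Qed.

Fact hyper_addN : left_inverse h0 hopp hadd.
Proof. by apply: (@lift1 (Eq (A (N X) X) O)) => x y z; apply: addNr. Qed.

Fact hyper_mulA : associative hmul.
Proof. by apply: (@lift (Eq (M X (M Y Z)) (M (M X Y) Z))) => x y z; apply: mulrA. Qed.

Fact hyper_mulC : commutative hmul.
Proof. by apply: (@lift2 (Eq (M X Y) (M Y X))) => x y z; apply: mulrC. Qed.

Fact hyper_mul1 : left_id h1 hmul.
Proof. by apply: (@lift1 (Eq (M U X) X)) => x y z; apply: mul1r. Qed.

Fact hyper_mulDl : left_distributive hmul hadd.
Proof.
by apply: (@lift (Eq (M (A X Y) Z) (A (M X Z) (M Y Z)))) => x y z; apply: mulrDl.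
Qed.

HB.instance Definition _ := gen_eqMixin (hyper E).
HB.instance Definition _ := gen_choiceMixin (hyper E).
HB.instance Definition _ := GRing.isZmodule.Build (hyper E)
  hyper_addA hyper_addC hyper_add0 hyper_addN.

Fact hyper_oner_neq0 : h1 != 0 :> hyper E.
Proof.
apply/eqP; apply: (@lift1 (Imp (Eq U O) (Bot _)) _ h0) => x y z.
exact/eqP/oner_neq0.
Qed.

HB.instance Definition _ := GRing.Zmodule_isComNzRing.Build (hyper E)
  hyper_mulA hyper_mulC hyper_mul1 hyper_mulDl hyper_oner_neq0.

Fact hyper_mulVf x : x != 0 -> hinv x * x = 1.
Proof.
move=> /eqP; move: x.
apply: (@lift1 (Imp (Imp (Eq X O) (Bot _)) (Eq (M (I X) X) U))) => x y z.
by move=> /eqP; apply: mulVf.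
Qed.

Fact hyper_invr0 : hinv 0 = 0.
Proof. by apply: (@lift1 (Eq (I O) O) _ h0) => x y z; apply: invr0. Qed.

HB.instance Definition _ := GRing.ComNzRing_isField.Build (hyper E)
  hyper_mulVf hyper_invr0.

Fact hyper_le0_add x y : hle 0 x -> hle 0 y -> hle 0 (x + y).
Proof.
move=> /asboolP x0 /asboolP y0; apply/asboolP; move: x y x0 y0.
apply: (@lift2 (Imp (L O X) (Imp (L O Y) (L O (A X Y))))) => x y z.
exact: addr_ge0.
Qed.

Fact hyper_le0_mul x y : hle 0 x -> hle 0 y -> hle 0 (x * y).
Proof.
move=> /asboolP x0 /asboolP y0; apply/asboolP; move: x y x0 y0.
apply: (@lift2 (Imp (L O X) (Imp (L O Y) (L O (M X Y))))) => x y z.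
exact: mulr_ge0.
Qed.

Fact hyper_le0_anti x : hle 0 x -> hle x 0 -> x = 0.
Proof.
move=> /asboolP + /asboolP; move: x.
apply: (@lift1 (Imp (L O X) (Imp (L X O) (Eq X O)))) => x y z /= x0 x0'.
by apply/eqP; rewrite eq_le x0 x0'.
Qed.

Fact hyper_sub_ge0 x y : hle 0 (y - x) = hle x y.
Proof.
apply/asboolP/asboolP; move: x y.
  apply: (@lift2 (Imp (L O (A Y (N X))) (L X Y))) => x y z xy.
  by have : 0 <= y - x := xy; rewrite subr_ge0.
apply: (@lift2 (Imp (L X Y) (L O (A Y (N X))))) => x y z xy.
by suff : 0 <= y - x by []; rewrite subr_ge0.
Qed.

Fact hyper_le0_total x : hle 0 x || hle x 0.
Proof.
apply/orP; suff [?|?] : @hrel R E leset 0 x \/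
  @hrel R E leset x 0 by [left; apply/asboolP|right; apply/asboolP].
move: x; apply: (@lift1 (Or (L O X) (L X O))) => x y z /=.
exact/orP/le_total.
Qed.

Fact hyper_normN x : habs (- x) = habs x.
Proof. by move: x; apply: (@lift1 (Eq (B (N X)) (B X))) => x y z; apply: normrN. Qed.

Fact hyper_ge0_norm x : hle 0 x -> habs x = x.
Proof.
move=> /asboolP; move: x.
by apply: (@lift1 (Imp (L O X) (Eq (B X) X))) => x y z; apply: ger0_norm.
Qed.

HB.instance Definition _ := Num.IntegralDomain_isLeReal.Build (hyper E)
  hyper_le0_add hyper_le0_mul hyper_le0_anti hyper_sub_ge0 hyper_le0_total
  hyper_normN hyper_ge0_norm (fun _ _ => erefl).

End FieldStructure.

Section Nonstandard.
Variables (R : realType) (E : nonstandard_extension R).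
Implicit Types (x y : hyper E) (f : hyper E -> hyper E).

Definition infinitesimal x : Prop := forall r : R, 0 < r -> `|x| < hstd E r.

Definition infclose x y : Prop := infinitesimal (x - y).

Definition finite_hyper x : Prop := exists2 r : R, 0 < r & `|x| < hstd E r.

Definition nearstandard x : Prop := exists b : R, infclose x (hstd E b).

Definition gtrsim x y : Prop := y <= x \/ infclose x y.

(* The elements of [E (Arr Reals Reals)] are the elements of *(R^R). *)
Definition internal f : Prop :=
  exists F : E (Arr Reals Reals), forall x, f x = sapp F x.

Definition mu_derivative f (f' : hyper E -> hyper E) : Prop :=
  [/\ internal f, internal f',
      (forall x, nearstandard x -> nearstandard (f x)),
      (forall x, nearstandard x -> finite_hyper (f' x)) &
      forall b : R, exists delta : hyper E,
        [/\ 0 < delta, infinitesimal delta &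
          forall x y, infclose x (hstd E b) -> infclose y (hstd E b) ->
            delta < `|x - y| ->
            exists2 eta : hyper E, infinitesimal eta &
              f x - f y = f' x * (x - y) + `|x - y| * eta]].

(* [D j] stands for the j-th mu-derivative; its values for j > k are
   irrelevant. *)
Definition mu_derivatives (k : nat) f (D : nat -> hyper E -> hyper E) : Prop :=
  D 0 = f /\ forall j, (j < k)%N -> mu_derivative (D j) (D j.+1).

Definition local_m_minimizer f (a : R) : Prop :=
  exists2 r : R, 0 < r &
    forall x, hset E `]a - r, a + r[ x -> gtrsim (f x) (f (hstd E a)).

End Nonstandard.

(* Main.v *)
Require Import Defs.
From mathcomp Require Import all_boot all_order all_algebra reals.
From mathcomp Require Import boolp classical_sets.
From mathcomp Require Import topology normedtype derive realfun.
From mathcomp Require Import ring lra.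

(** Each [F_j(b) := st (f^(j)(b))] is a function on the reals. The mu-derivative
    condition at a real point [b] says that no infinitesimal [h] with
    [delta_b < |h|] makes the increment of [f^(j)] differ from [f^(j+1)(b) h] by
    more than [e |h|]; by underspill no [h] below some positive real does.
    A nonzero real [h] exceeds [delta_b], so taking standard parts gives
    [F_j' = F_(j+1)] everywhere. Then [a] is an ordinary local minimizer of [F_0]
    and the classical higher-order derivative test applies. *)

Set Implicit Arguments.
Unset Strict Implicit.
Unset Printing Implicit Defensive.

Import Order.TTheory GRing.Theory Num.Theory.
Import numFieldNormedType.Exports.
Local Open Scope ring_scope.

(** * The reals as an ordered subfield of the hyperreals *)

Section Embedding.
Variables (R : realType) (E : nonstandard_extension R).

Lemma star_app s t (u : standard R (Arr s t)) (x : standard R s) :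
  star E (sapp u x) = sapp (star E u) (star E x).
Proof.
symmetry.
by apply/(transfer E (Defs.Eq (App (Var (VZ [:: s; t] (Arr s t)))
  (Var (VS _ (VZ _ s)))) (Var (VS _ (VS _ (VZ _ t))))) (u, (x, (u x, tt)))).
Qed.

Lemma star_mem s (A : standard R (Pow s)) (x : standard R s) :
  smem (star E x) (star E A) <-> smem x A.
Proof.
symmetry; exact: (transfer E (Defs.Mem (Var (VZ [:: Pow s] s))
  (Var (VS _ (VZ _ (Pow s))))) (x, (A, tt))).
Qed.

Lemma hfun_std (u : R -> R) r : hfun u (hstd E r) = hstd E (u r).
Proof. by rewrite /hfun /hstd -star_app. Qed.

Lemma hfun2_std (u : R -> R -> R) r s :
  hfun2 u (hstd E r) (hstd E s) = hstd E (u r s).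
Proof. by rewrite /hfun2 /hstd -!star_app. Qed.

Lemma hstdD r s : hstd E (r + s) = hstd E r + hstd E s.
Proof. by rewrite -hfun2_std. Qed.

Lemma hstdM r s : hstd E (r * s) = hstd E r * hstd E s.
Proof. by rewrite -hfun2_std. Qed.

Lemma hstdN r : hstd E (- r) = - hstd E r.
Proof. by rewrite -hfun_std. Qed.

Lemma hstdB r s : hstd E (r - s) = hstd E r - hstd E s.
Proof. by rewrite hstdD hstdN. Qed.

Lemma hstd_norm r : hstd E `|r| = `|hstd E r|.
Proof. by rewrite -hfun_std. Qed.

Lemma hstd0 : hstd E 0 = 0. Proof. by []. Qed.

Lemma hstd_le r s : (hstd E r <= hstd E s) = (r <= s).
Proof.
(* This [leset] is convertible to the relation whose star image defines [<=] on [hyper E], so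
   comparing standard points is an instance of transferred membership. *)
pose leset (t : R) : set R := fun t' => t <= t'.
have := star_mem (s := Reals) (leset r) s.
rewrite (star_app (s := Reals) (t := Pow Reals) leset r) => leP.
by apply/asboolP/idP => /leP.
Qed.

Lemma hstd_lt r s : (hstd E r < hstd E s) = (r < s).
Proof. by rewrite !ltNge hstd_le. Qed.

End Embedding.

(** * Calculus of infinitesimals and standard parts *)

Section Infinitesimal.
Variables (R : realType) (E : nonstandard_extension R).
Implicit Types x y : hyper E.

Lemma infinitesimal_small x y :
  infinitesimal y -> `|x| <= `|y| -> infinitesimal x.
Proof. by move=> yi xy r r0; apply: le_lt_trans xy (yi r r0). Qed.

Lemma infinitesimalD x y :
  infinitesimal x -> infinitesimal y -> infinitesimal (x + y).
Proof.
move=> xi yi r r0; have r20 : 0 < r / 2 by lra.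
rewrite (splitr r) hstdD.
exact: le_lt_trans (ler_normD _ _) (ltrD (xi _ r20) (yi _ r20)).
Qed.

Lemma infinitesimalN x : infinitesimal x -> infinitesimal (- x).
Proof. by move=> xi; apply: infinitesimal_small xi _; rewrite normrN. Qed.

Lemma infinitesimalMl (r : R) x : infinitesimal x -> infinitesimal (hstd E r * x).
Proof.
move=> xi s s0.
have r0 : 0 < `|r| + 1 by have := normr_ge0 r; lra.
(* The bound on [x] is taken at [s / (|r| + 1)]; the added 1 keeps the divisor positive when
   [r = 0]. *)
have -> : s = (`|r| + 1) * (s / (`|r| + 1)) by field; rewrite gt_eqF.
rewrite normrM -hstd_norm hstdM.
have := xi _ (divr_gt0 s0 r0); set t := hstd E (s / _) => xt.
have r1 : hstd E `|r| < hstd E (`|r| + 1) by rewrite hstd_lt ltrDl.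
have p0 : 0 < hstd E (`|r| + 1) by rewrite -hstd0 hstd_lt.
apply: le_lt_trans (_ : hstd E (`|r| + 1) * `|x| < _).
  by apply: ler_wpM2r => //; apply: ltW.
by rewrite ltr_pM2l.
Qed.

Lemma infinitesimal0 : infinitesimal (0 : hyper E).
Proof. by move=> r r0; rewrite normr0 -hstd0 hstd_lt. Qed.

Lemma infclose_sym x y : infclose x y -> infclose y x.
Proof. by move=> /infinitesimalN; rewrite opprB. Qed.

Lemma infclose_refl x : infclose x x.
Proof. by rewrite /infclose subrr; apply: infinitesimal0. Qed.

Lemma infclose_std_le x (r s : R) :
  infclose x (hstd E r) -> x <= hstd E s -> r <= s.
Proof.
move=> xr xs; rewrite leNgt; apply/negP => sr.
have := xr (r - s); rewrite subr_gt0 => /(_ sr).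
rewrite hstdB distrC => xrs.
have := le_lt_trans (ler_norm _) xrs; lra.
Qed.

Lemma infclose_std_eq (r s : R) : infclose (hstd E r) (hstd E s) -> r = s.
Proof.
move=> rs; apply/eqP; rewrite eq_le.
by rewrite (infclose_std_le (infclose_sym rs)) // (infclose_std_le rs).
Qed.

Lemma infclose_trans y x z : infclose x y -> infclose y z -> infclose x z.
Proof. by move=> xy yz; rewrite /infclose -(subrKA y); apply: infinitesimalD. Qed.

Lemma infcloseB x y x' y' :
  infclose x x' -> infclose y y' -> infclose (x - y) (x' - y').
Proof.
move=> xx' yy'; rewrite /infclose.
have -> : x - y - (x' - y') = (x - x') - (y - y') by ring.
by apply: infinitesimalD => //; apply: infinitesimalN.
Qed.

Lemma infclose_le x y (r s : R) : infclose x (hstd E r) ->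
  infclose y (hstd E s) -> gtrsim y x -> r <= s.
Proof.
move=> xr ys [xy|xy].
  rewrite -subr_le0; apply: (@infclose_std_le (x - y)).
    by rewrite hstdB; apply: infcloseB.
  by rewrite hstd0 subr_le0.
by rewrite (infclose_std_eq (infclose_trans (infclose_sym ys)
  (infclose_trans xy xr))).
Qed.

(** By completeness of the reals, the set of reals below [x] has a supremum, and no positive real
    separates [x] from it. *)
Lemma finite_nearstandard x : finite_hyper x -> nearstandard x.
Proof.
case=> M M0; rewrite ltr_norml => /andP[Mx xM].
pose A : set R := fun r => hstd E r <= x.
have ubA : ubound A M.
  by move=> r Ar; rewrite -(hstd_le E); apply: le_trans Ar (ltW xM).
have supA : has_sup A.
  by split; [exists (- M); rewrite /A hstdN; apply: ltW | exists M].
exists (sup A) => r r0; rewrite ltr_norml; apply/andP; split.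
  have [t At tA] := sup_adherent r0 supA.
  rewrite ltrBrDl -hstdB; apply: lt_le_trans At.
  by rewrite hstd_lt.
rewrite ltrBlDl -hstdD ltNge; apply/negP => Ar.
have := ub_le_sup supA.2 Ar; lra.
Qed.

(** The default 0 is taken only where [x] is not nearstandard; elsewhere the real is unique by
    [infclose_std_eq]. *)
Definition st x : R := xget 0 (fun b => infclose x (hstd E b)).

Lemma infclose_st x : nearstandard x -> infclose x (hstd E (st x)).
Proof. by move=> [b xb]; rewrite /st; case: xgetP => [y _|/(_ b)]. Qed.

Lemma nearstandard_std r : nearstandard (hstd E r).
Proof. by exists r; apply: infclose_refl. Qed.

End Infinitesimal.

(** * Internal sets of hyperreals and underspill *)

Section Underspill.
Variables (R : realType) (E : nonstandard_extension R).
Implicit Types x h : hyper E.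

Let rel := Arr Reals (Pow Reals).
Let fun1 := Arr Reals Reals.
Let fun2 := Arr Reals fun1.
Let leset (r : R) : set R := fun s => r <= s.

Let ops : lenv (standard R) [:: rel; fun1; fun2; fun2; fun1; Reals] :=
  (leset, ((Num.norm : R -> R), (+%R, ( *%R, (-%R, (0, tt)))))).

Let Not G (p : lform G) := Imp p (Bot G).
Let Iff G (p q : lform G) := And (Imp p q) (Imp q p).
Let Le G (le : lterm G rel) t u := Defs.Mem u (App le t).

Local Notation v0 := (VZ _ _).
Local Notation v1 := (VS _ v0).
Local Notation v2 := (VS _ v1).
Local Notation v3 := (VS _ v2).
Local Notation v4 := (VS _ v3).
Local Notation v5 := (VS _ v4).
Local Notation v6 := (VS _ v5).
Local Notation v7 := (VS _ v6).
Local Notation v8 := (VS _ v7).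
Local Notation v9 := (VS _ v8).
Local Notation v10 := (VS _ v9).
Local Notation v11 := (VS _ v10).

(* In the innermost scope the variables 0-3 are y, x, d, A and 4-9 are the
   entries of [ops]. *)
Let near_minimum : lform [:: rel; fun1; fun2; fun2; fun1; Reals] :=
  @All _ (Pow Reals) (@All _ Reals (Imp (Not (Le (Var v2) (Var v0) (Var v7)))
    (Imp (@Ex _ Reals (Defs.Mem (Var v0) (Var v2)))
      (@Ex _ Reals (And (Defs.Mem (Var v0) (Var v2))
        (@All _ Reals (Imp (Defs.Mem (Var v0) (Var v3))
          (Le (Var v4) (App (Var v5) (Var v1))
            (App (App (Var v6) (App (Var v5) (Var v0))) (Var v2)))))))))).

Lemma le_hrel x y : (x <= y) <-> smem y (sapp (star E (s := rel) leset) x).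
Proof. by split => [/asboolP//|xy]; apply/asboolP. Qed.

(* The infimum of the absolute values need not be attained, hence the [d]. *)
Lemma exists_near_minimum (A : E (Pow Reals)) (d : hyper E) :
  0 < d -> (exists x, smem x A) ->
  exists2 x : hyper E, smem x A & forall y : hyper E, smem y A -> `|x| <= `|y| + d.
Proof.
move=> d0 A0; suff H : holds near_minimum (lenv_map (star E) ops).
  have [|x [Ax xA]] := H A d _ A0.
    by move=> /le_hrel d0'; have := lt_le_trans d0 d0'; rewrite ltxx.
  by exists x => // y Ay; apply/le_hrel/xA.
apply/(transfer E near_minimum ops) => B e /= e0 [x0 Bx0].
have {}e0 : 0 < e by rewrite ltNge; apply/negP.
pose N : set R := fun r => exists2 x, B x & r = `|x|.
have infN : has_inf N.
  split; first by exists `|x0|, x0.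
  by exists 0 => _ [x _ ->].
have [_ [x Bx ->] xN] := inf_adherent e0 infN.
exists x; split=> // y By; rewrite /leset.
apply: le_trans (ltW xN) _; rewrite lerD2r.
by apply: (ge_inf infN.2); exists y.
Qed.

(** An element [x] of [A] that is minimal in absolute value up to the infinitesimal [d] is itself
    not infinitesimal, so [|x|] is at least some real [r > 0]. All other elements then have absolute
    value at least [r - d], which exceeds [r / 2]. *)
Lemma underspill (A : E (Pow Reals)) :
  (exists2 d : hyper E, 0 < d & infinitesimal d) ->
  (forall x : hyper E, smem x A -> ~ infinitesimal x) ->
  exists2 r : R, 0 < r & forall x : hyper E, smem x A -> hstd E r <= `|x|.
Proof.
move=> [d d0 di] Ai.
have [/(exists_near_minimum d0)[x Ax xA]|A0] := pselect (exists x, smem x A); last first.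
  by exists 1 => // x Ax; case: A0; exists x.
have : exists2 r : R, 0 < r & hstd E r <= `|x|.
  apply: contrapT => nr; apply: (Ai _ Ax) => r r0; rewrite ltNge.
  by apply/negP => rx; apply: nr; exists r.
move=> [r r0 rx]; exists (r / 2) => [|y /xA xy]; first by rewrite divr_gt0.
have r20 : 0 < r / 2 by lra.
have := le_lt_trans (ler_norm d) (di _ r20).
have := le_trans rx xy; rewrite {1}(splitr r) hstdD; lra.
Qed.

(* In the innermost scope the variables 0-6 are h, A, e, d, c, b, f and 7-12 are
   the entries of [ops]. *)
Let difference_quotient_set : lform [:: rel; fun1; fun2; fun2; fun1; Reals] :=
  @All _ fun1 (@All _ Reals (@All _ Reals (@All _ Reals (@All _ Reals
    (@Ex _ (Pow Reals) (@All _ Reals (Iff (Defs.Mem (Var v0) (Var v1))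
      (And (Not (Le (Var v7) (App (Var v8) (Var v0)) (Var v3)))
        (Not (Le (Var v7)
          (App (Var v8) (App (App (Var v9)
            (App (App (Var v9)
              (App (Var v6) (App (App (Var v9) (Var v5)) (Var v0))))
              (App (Var v11) (App (Var v6) (Var v5)))))
            (App (Var v11) (App (App (Var v10) (Var v4)) (Var v0)))))
          (App (App (Var v10) (Var v2)) (App (Var v8) (Var v0))))))))))))).

(** [underspill] applies only to internal sets. That the increments [h] with a large error form one
    is comprehension over the reals, transferred with [f], [b], [c], [d] and [e] universally
    quantified. *)
Lemma exists_difference_quotient_set f (b c d e : hyper E) : internal f ->
  exists A : E (Pow Reals), forall h : hyper E, smem h A <->
    d < `|h| /\ e * `|h| < `|f (b + h) - f b - c * h|.
Proof.
move=> [F fF].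
suff H : holds difference_quotient_set (lenv_map (star E) ops).
  have [A AP] := H F b c d e; exists A => h; rewrite !fF !ltNge.
  split=> [/(AP h).1[p q]|[/negP p /negP q]].
    by split; apply/negP => /le_hrel.
  by apply: (AP h).2; split; move=> /le_hrel.
apply/(transfer E difference_quotient_set ops) => G b' c' d' e'.
exists (fun h : R => ~ (`|h| <= d') /\
  ~ (`|G (b' + h) + - G b' + - (c' * h)| <= e' * `|h|)) => h.
by split.
Qed.

End Underspill.

(** * Standard parts of mu-derivatives are classical derivatives *)

Section StandardDerivative.
Variables (R : realType) (E : nonstandard_extension R).
Implicit Types f : hyper E -> hyper E.

Lemma is_derive_linear_approx (F : R -> R) (b c : R) :
  (forall e : R, 0 < e -> exists2 r : R, 0 < r & forall h : R, 0 < `|h| < r ->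
    `|F (b + h) - F b - c * h| <= e * `|h|) ->
  is_derive b 1 F c.
Proof.
move=> FP; suff Fc : (h^-1 *: (F (h *: 1 + b) - F b) @[h --> 0^'] --> c)%classic.
  by apply: DeriveDef; [apply/cvg_ex; exists c | apply/cvg_lim].
apply/cvgrPdist_le => e e0; have [r r0 rP] := FP e e0.
near=> h.
have h0 : h != 0 by near: h; exact: nbhs_dnbhs_neq.
have hr : `|h| < r by near: h; exact: dnbhs0_lt.
have hp : 0 < `|h| by rewrite normr_gt0.
have := rP h; rewrite hp hr => /(_ isT) Fh.
rewrite -(ler_pM2r hp); apply: le_trans Fh.
rewrite -normrM distrC.
rewrite le_eqVlt; apply/orP; left; apply/eqP; congr `|_|.
rewrite /GRing.scale /= mulr1 (addrC h b); field.
by [].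
Unshelve. all: end_near. Qed.

Definition st_fun f (b : R) : R := st (f (hstd E b)).

Lemma mu_derivative_nearstandard f f' (b : R) : mu_derivative f f' ->
  nearstandard (f (hstd E b)) /\ nearstandard (f' (hstd E b)).
Proof.
move=> [_ _ fn f'n _]; split; first exact/fn/nearstandard_std.
exact/finite_nearstandard/f'n/nearstandard_std.
Qed.

Lemma mu_derivative_is_derive f f' (b : R) : mu_derivative f f' ->
  is_derive b 1 (st_fun f) (st_fun f' b).
Proof.
move=> ff'; apply: is_derive_linear_approx => e e0.
have [_ f'b] := mu_derivative_nearstandard b ff'.
have [fi _ fn _ /(_ b)[d [d0 di dP]]] := ff'.
have [A AP] := exists_difference_quotient_set (hstd E b) (f' (hstd E b)) d
  (hstd E e) fi.
have [h Ah hi|r r0 rA] := underspill (A := A) (ex_intro2 _ _ d d0 di).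
  (* An infinitesimal [h] cannot lie in [A]: the mu-derivative condition at [b] and [b + h], with
     the derivative evaluated at [b], gives an error [|h| * eta], at most [e * |h|]. *)
  have [dh] := (AP h).1 Ah; apply/negP; rewrite -leNgt.
  have [|||eta etai] := dP (hstd E b) (hstd E b + h).
  - exact: infclose_refl.
  - by rewrite /infclose addrAC subrr add0r.
  - by rewrite opprD addNKr normrN.
  rewrite opprD addNKr normrN => fE.
  have -> : f (hstd E b + h) - f (hstd E b) - f' (hstd E b) * h = - (`|h| * eta).
    have := fE; move: (f _) (f _) (f' _) => u v w uv.
    by rewrite -(opprB v u) uv; ring.
  rewrite normrN normrM normr_id mulrC; apply: ler_wpM2r => //.
  exact/ltW/etai.
exists r => // h /andP[h0 hr].
(* The wanted real inequality is the standard part of the same inequality for the values of [f] and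
   [f']; multiplying by the real [h] preserves infinite closeness. *)
have := @infclose_std_le _ E `|f (hstd E (b + h)) - f (hstd E b) -
  f' (hstd E b) * hstd E h|.
apply.
  rewrite hstd_norm; apply: infinitesimal_small (ler_dist_dist _ _).
  rewrite !hstdB hstdM (mulrC _ (hstd E h)) (mulrC _ (hstd E h)).
  apply: infcloseB.
    by apply: infcloseB; apply/infclose_st/fn/nearstandard_std.
  rewrite /infclose -mulrBr; apply: infinitesimalMl; exact: infclose_st.
(* If that inequality failed, [h] would lie in [A], since a nonzero real exceeds the infinitesimal
   [d]; but [|h| < r]. *)
rewrite leNgt; apply/negP => hA.
have : smem (hstd E h) A.
  apply/AP; rewrite -hstdD -hstd_norm -hstdM; split=> //.
  exact: le_lt_trans (ler_norm d) (di _ h0).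
by move=> /rA; rewrite -hstd_norm hstd_le leNgt hr.
Qed.

End StandardDerivative.

(** * The classical higher-order derivative test *)

Section HigherOrderTest.
Variable R : realType.
Implicit Types (F : nat -> R -> R) (a : R).

(** The inequality descends from order [k - 1] to order 0. Where a derivative vanishes at [a] and
    lies below that value on the right, it is negative there, and the mean value theorem gives the
    same inequality one order lower. *)
Lemma lt_right_of_negative_derivative F a k : (0 < k)%N ->
  (forall j (x : R), (j < k)%N -> is_derive x 1 (F j) (F j.+1 x)) ->
  (forall j, (0 < j < k)%N -> F j a = 0) -> F k a < 0 ->
  exists2 r : R, 0 < r & forall x, a < x < a + r -> F 0 x < F 0 a.
Proof.
case: k => // k _ dF F0 Fk.
suff H j : (j <= k)%N -> exists2 r : R, 0 < r &
    forall x, a < x < a + r -> F (k - j)%N x < F (k - j)%N a.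
  by have := H k (leqnn k); rewrite subnn.
elim: j => [_|j IH jk].
  (* After the case split the top order is [k.+1]. The difference quotients of [F k] at [a] tend to
     [F k.+1 a < 0], so they are negative near [a]. *)
  rewrite subn0; have dFk := dF k a (ltnSn k).
  have : (h^-1 *: (F k (h *: 1 + a) - F k a) @[h --> 0^'] --> F k.+1 a)%classic.
    have /cvg_ex[l Fl] := ex_derive (is_derive := dFk).
    by have := derive_val (is_derive := dFk); rewrite /derive (cvg_lim _ Fl) // => <-.
  move=> /cvgr_lt /(_ _ Fk) /nbhs_ballP[r /= r0 rP]; exists r => // x /andP[ax xr].
  have xa0 : 0 < x - a by rewrite subr_gt0.
  have := rP (x - a); rewrite /ball /= sub0r normrN gtr0_norm // ltrBlDl xr.
  rewrite gt_eqF // => /(_ isT isT); rewrite /GRing.scale /= mulr1 subrK.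
  by rewrite pmulr_rlt0 ?invr_gt0 // subr_lt0.
have [r r0 rP] := IH (ltnW jk); exists r => // x /andP[ax xr].
have kj : (k - j = (k - j.+1).+1)%N by rewrite subnSK.
have dFj (y : R) : is_derive y 1 (F (k - j.+1)%N) (F (k - j)%N y).
  by rewrite kj; apply: dF; rewrite ltnS leq_subr.
have [|c /andP[]] := MVT ax (fun (y : R) _ => dFj y).
  by apply: derivable_within_continuous => z _; exact: ex_derive.
rewrite !bnd_simp => ac cx Fc; rewrite -subr_lt0 Fc pmulr_llt0 ?subr_gt0 //.
rewrite -(F0 (k - j)%N); first by apply: rP; rewrite ac (lt_trans cx xr).
by rewrite subn_gt0 jk ltnS leq_subr.
Qed.

(** Only a right neighbourhood is involved, so that the lemma can be applied both to a function and
    to its reflection. *)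
Lemma nth_derivative_ge0_of_right_min F a k (r : R) : (0 < k)%N ->
  (forall j (x : R), (j < k)%N -> is_derive x 1 (F j) (F j.+1 x)) ->
  (forall j, (0 < j < k)%N -> F j a = 0) ->
  0 < r -> (forall x, a < x < a + r -> F 0 a <= F 0 x) -> 0 <= F k a.
Proof.
move=> k0 dF F0 r0 Fmin; rewrite leNgt; apply/negP => Fk.
have [s s0 Fs] := lt_right_of_negative_derivative k0 dF F0 Fk.
pose t := Num.min r s / 2.
have m0 : 0 < Num.min r s by rewrite lt_min r0.
have [mr ms] : Num.min r s <= r /\ Num.min r s <= s by rewrite !ge_min !lexx orbT.
have [tr ts] : a < a + t < a + r /\ a < a + t < a + s by rewrite /t; split; lra.
by have := le_lt_trans (Fmin _ tr) (Fs _ ts); rewrite ltxx.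
Qed.

Lemma is_derive_reflection (u : R -> R) (x l : R) :
  is_derive (- x) 1 u l -> is_derive x 1 (fun y => u (- y)) (- l).
Proof.
move=> ul; rewrite -[- l]mulrN1; exact: (is_derive1_comp (g := -%R)).
Qed.

(* The left-hand side is the right-hand side for the reflected family
   [(-1)^j F_j(-x)], which is again a chain of derivatives. *)
Lemma higher_order_minimum_test F a k (r : R) : (0 < k)%N ->
  (forall j (x : R), (j < k)%N -> is_derive x 1 (F j) (F j.+1 x)) ->
  (forall j, (0 < j < k)%N -> F j a = 0) ->
  0 < r -> (forall x, a - r < x < a + r -> F 0 a <= F 0 x) ->
  0 <= F k a /\ (odd k -> F k a = 0).
Proof.
move=> k0 dF F0 r0 Fmin.
have Fk0 : 0 <= F k a.
  apply: (nth_derivative_ge0_of_right_min k0 dF F0 r0) => x xar.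
  by apply: Fmin; lra.
split=> // kodd; apply/eqP; rewrite eq_le Fk0 andbT.
pose G j x := (-1) ^+ j * F j (- x).
suff : 0 <= G k (- a) by rewrite /G opprK -signr_odd kodd mulN1r oppr_ge0.
apply: (nth_derivative_ge0_of_right_min (r := r) k0) => // [j x jk|j jk|x xar].
- rewrite /G exprSr -mulrA mulN1r.
  have := is_derive_reflection (dF j (- x) jk).
  by move=> Fd; apply: is_deriveZ.
- by rewrite /G opprK F0 // mulr0.
- by rewrite /G !expr0 !mul1r opprK; apply: Fmin; lra.
Qed.

End HigherOrderTest.

(** * Transfer of the classical test back to the mu-derivatives *)

Theorem mainTheorem4 (R : realType) (E : nonstandard_extension R) (k : nat)
  (hk : (1 <= k)%N) (f : hyper E -> hyper E) (hf : internal f)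
  (D : nat -> hyper E -> hyper E) (hD : mu_derivatives k f D) (a : R)
  (hmin : local_m_minimizer f a)
  (hcrit : forall j, (1 <= j < k)%N -> infclose (D j (hstd E a)) 0) :
  (odd k -> infclose (D k (hstd E a)) 0) /\
  (~~ odd k -> gtrsim (D k (hstd E a)) 0).
Proof.
case: hD => D0 dD; have [r r0 rmin] := hmin.
have Dst j b : (j <= k)%N -> infclose (D j (hstd E b)) (hstd E (st_fun (D j) b)).
  (* Order 0 is nearstandard because [D 0] preserves nearstandard points; order [j.+1] because it is
     finite as a mu-derivative of [D j]. This reaches the top order [k]. *)
  case: j => [_|j jk]; apply: infclose_st.
    exact: (mu_derivative_nearstandard b (dD 0%N hk)).1.
  exact: (mu_derivative_nearstandard b (dD j jk)).2.
have [||x xar|Fk0 Fkodd] := @higher_order_minimum_test R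
    (fun j => st_fun (D j)) a k r hk _ _ r0 _.
- by move=> j x jk; apply/mu_derivative_is_derive/dD.
- move=> j /andP[j0 jk]; apply: (@infclose_std_eq R E).
  rewrite hstd0; apply: infclose_trans (hcrit j _); last by rewrite j0 jk.
  exact/infclose_sym/Dst/ltnW.
- apply: (infclose_le (Dst 0%N a isT) (Dst 0%N x isT)); rewrite D0.
  by apply: rmin; apply: (star_mem E (s := Reals) _ _).2; rewrite /= in_itv.
have Dk := Dst k a (leqnn k).
split=> [/Fkodd Fk|_]; first by rewrite Fk in Dk.
(* A zero standard part gives the infinitely close alternative of [gtrsim]. A positive one, used as
   the radius of closeness, forces [D k] at [a] to be positive. *)
have [Fk|Fk] := eqVneq (st_fun (D k) a) 0.
  by right; rewrite Fk in Dk.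
have {Fk Fk0}Fk : 0 < st_fun (D k) a by rewrite lt0r Fk.
left; have := Dk _ Fk; rewrite distrC => /(le_lt_trans (ler_norm _)).
by rewrite ltrBlDl ltrDr => /ltW.
Qed.
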